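(* Let $\alpha=(\alpha_1,\dots,\alpha_n)\in\mathbb{Z}_{\ge 0}^n$ be a composition that is not weakly decreasing, let $r$ be its first ascent (i.e. $\alpha_1\ge\alpha_2\ge\cdots\ge\alpha_r$ and $\alpha_r<\alpha_{r+1}$), and let $\alpha'$ be obtained from $\alpha$ by interchanging $\alpha_r$ and $\alpha_{r+1}$. Then $$\pi_r\left(\sum_{F'\in \mathrm{SSF}(\alpha')}x^{F'}\right)=\sum_{F\in \mathrm{SSF}(\alpha)}x^F.$$
   Context: **Demazure operator.** For $f\in\mathbb{Z}[x_1,\dots,x_n]$, $s_if$ is obtained from $f$ by interchanging $x_i$ and $x_{i+1}$, $\partial_i(f)=\dfrac{f-s_if}{x_i-x_{i+1}}$, and $\pi_i(f)=\partial_i(x_if)$. **Skyline fillings.** For a composition $\alpha=(\alpha_1,\dots,\alpha_n)\in\mathbb{Z}_{\ge0}^n$, the skyline diagram $D(\alpha)$ is the left-justified array with $\alpha_i$ boxes in row $i$; row indices increase from top to bottom, column indices from left to right, and $(i,j)$ is the box in row $i$, column $j$. A skyline filling $F$ for $\alpha$ assigns a positive integer $F(i,j)$ to each box $(i,j)\in D(\alpha)$. It is semistandard if: (i) entries weakly decrease from left to right in each row; (ii) $F(i,j)\le i$ for every box (flag condition); (iii) entries in each column are distinct; (iv) if $(i,j),(i',j)\in D(\alpha)$ with $i'>i$ and $F(i',j)<F(i,j)$, then $(i,j+1)\in D(\alpha)$ and $F(i',j)<F(i,j+1)$. $\mathrm{SSF}(\alpha)$ is the set of semistandard skyline fillings for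 $\alpha$, and $x^F=\prod_{(i,j)\in D(\alpha)}x_{F(i,j)}$. *)

(* Defs.v *)
From HB Require Import structures.
From mathcomp Require Import all_boot all_order all_algebra all_fingroup.
From mathcomp Require Import mpoly.

Set Implicit Arguments.
Unset Strict Implicit.
Unset Printing Implicit Defensive.

Import GRing.Theory.
Local Open Scope ring_scope.

(* Indices are 0-based throughout: rows, columns, variables and compositions.
   The adjacent pairs (i, i + 1) of indices below n are indexed by 'I_n.-1,
   which is empty when n <= 1; [lo i] and [hi i] are the two members. *)
Definition lo n (i : 'I_n.-1) : 'I_n := widen_ord (leq_pred n) i.

Lemma hi_subproof n (i : 'I_n.-1) : (i.+1 < n)%N.
Proof. by case: n i => [|n] [i] //=. Qed.

Definition hi n (i : 'I_n.-1) : 'I_n := Ordinal (hi_subproof i).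

Definition swap n (i : 'I_n.-1) : 'S_n := tperm (lo i) (hi i).

Lemma lo_neq_hi n (i : 'I_n.-1) : lo i != hi i.
Proof. by rewrite -val_eqE /= neq_ltn ltnSn. Qed.

Lemma divdiff_subproof n (i : 'I_n.-1) (f : {mpoly int[n]}) :
  exists g : {mpoly int[n]},
    g * ('X_(lo i) - 'X_(hi i)) == f - msym (swap i) f.
Proof.
have X1 k : exists g : {mpoly int[n]},
    g * ('X_(lo i) - 'X_(hi i)) == 'X_k - msym (swap i) 'X_k.
  have E : msym (swap i) 'X_k = 'X_(swap i k) :> {mpoly int[n]}.
    by rewrite /msym mmapX mmap1U.
  rewrite E /swap; case: tpermP => [->|->|_ _].
  - by exists 1; rewrite mul1r.
  - by exists (-1); rewrite mulN1r opprB.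
  - by exists 0; rewrite mul0r subrr.
pose P (f : {mpoly int[n]}) := exists g : {mpoly int[n]},
  g * ('X_(lo i) - 'X_(hi i)) == f - msym (swap i) f.
have P1 : P 1 by exists 0; rewrite mul0r msym1 subrr.
have PM p q : P p -> P q -> P (p * q).
  move=> [g /eqP Hg] [h /eqP Hh]; exists (g * q + msym (swap i) p * h).
  by rewrite mulrDl mulrAC Hg -mulrA Hh msymM mulrBl mulrBr addrA subrK.
rewrite -/(P f); elim/mpolyind: f => [|c m p _ _ [g /eqP Hg]].
  by exists 0; rewrite msym0 mul0r subrr.
have [h /eqP Hh] : P 'X_[m].
  rewrite (mpolyXE _ 1); apply: (big_ind P) => // k _.
  by rewrite perm1; elim: (m k) => [|e IHe]; rewrite ?expr0 // exprS; apply: PM.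
exists (c *: h + g).
by rewrite mulrDl -scalerAl Hh Hg msymD msymZ scalerBr opprD addrACA.
Qed.

(* The quotient (f - s_i f) / (x_i - x_{i+1}); it exists in the polynomial
   ring by [divdiff_subproof] and is unique by [divdiff_uniq]. *)
Definition divdiff n (i : 'I_n.-1) (f : {mpoly int[n]}) : {mpoly int[n]} :=
  xchoose (divdiff_subproof i f).

Lemma divdiffP n (i : 'I_n.-1) (f : {mpoly int[n]}) :
  divdiff i f * ('X_(lo i) - 'X_(hi i)) = f - msym (swap i) f.
Proof. exact/eqP/(xchooseP (divdiff_subproof i f)). Qed.

Lemma divdiff_uniq n (i : 'I_n.-1) (f g : {mpoly int[n]}) :
  g * ('X_(lo i) - 'X_(hi i)) = f - msym (swap i) f -> divdiff i f = g.
Proof.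
rewrite -divdiffP => /esym; apply: mulIf.
rewrite subr_eq0; apply/eqP => /(congr1 (mcoeff U_(lo i)%MM)) /eqP.
by rewrite !mcoeffXU eqxx [hi i == _]eq_sym (negPf (lo_neq_hi i)) oner_eq0.
Qed.

Definition demazure n (i : 'I_n.-1) (f : {mpoly int[n]}) : {mpoly int[n]} :=
  divdiff i ('X_(lo i) * f).

Definition weakly_decreasing n (alpha : 'I_n -> nat) : bool :=
  [forall i : 'I_n, forall j : 'I_n, (i <= j)%N ==> (alpha j <= alpha i)%N].

Definition first_ascent n (alpha : 'I_n -> nat) (r : 'I_n.-1) : bool :=
  [forall i : 'I_n.-1, (i < r)%N ==> (alpha (hi i) <= alpha (lo i))%N]
  && (alpha (lo r) < alpha (hi r))%N.

Definition box n (alpha : 'I_n -> nat) := {i : 'I_n & 'I_(alpha i)}.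

Section Skyline.
Variables (n : nat) (alpha : 'I_n -> nat).

Definition row (b : box alpha) : 'I_n := tag b.
Definition col (b : box alpha) : nat := tagged b.

(* Since rows are numbered from 0, the flag condition is F b <= (row b).+1. *)
Definition semistandard (F : box alpha -> nat) : bool :=
  [&& [forall b, 0 < F b],
      [forall b, forall b',
         (row b == row b') && (col b <= col b') ==> (F b' <= F b)],
      [forall b, F b <= (row b).+1],
      [forall b, forall b',
         (col b == col b') && (row b != row b') ==> (F b != F b')]
    & [forall b, forall b',
         [&& col b == col b', row b < row b' & F b' < F b] ==>
         [exists c,
            [&& row c == row b, col c == (col b).+1 & F b' < F c]]]]%N.

(* By the flag condition the entries lie in {1, ..., n}, so the value k : 'I_n
   encodes the entry k + 1, whose variable is 'X_k.  [ssfP] shows that no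
   filling by positive integers is lost. *)
Definition SSF : {set {ffun box alpha -> 'I_n}} :=
  [set F : {ffun box alpha -> 'I_n} | semistandard (fun b => (F b).+1)].

Definition weight (F : {ffun box alpha -> 'I_n}) : {mpoly int[n]} :=
  \prod_(b : box alpha) 'X_(F b).

Lemma eq_semistandard (F G : box alpha -> nat) :
  F =1 G -> semistandard F = semistandard G.
Proof.
move=> E; rewrite /semistandard; congr [&& _, _, _, _ & _].
- by apply: eq_forallb => b; rewrite E.
- by apply: eq_forallb => b; apply: eq_forallb => b'; rewrite !E.
- by apply: eq_forallb => b; rewrite E.
- by apply: eq_forallb => b; apply: eq_forallb => b'; rewrite !E.
- apply: eq_forallb => b; apply: eq_forallb => b'; rewrite !E.
  by congr (_ ==> _); apply: eq_existsb => c; rewrite E.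
Qed.

Lemma ssfP (F : box alpha -> nat) :
  semistandard F <->
  exists2 G : {ffun box alpha -> 'I_n}, G \in SSF & forall b, F b = (G b).+1.
Proof.
split=> [sF|[G]]; last by rewrite inE => sG /eq_semistandard ->.
have /and5P[/forallP pos _ /forallP flag _ _] := sF.
have lt b : ((F b).-1 < n)%N.
  by rewrite prednK // (leq_trans (flag b)) // ltn_ord.
have E b : F b = ([ffun b => Ordinal (lt b)] b).+1 by rewrite ffunE /= prednK.
by exists [ffun b => Ordinal (lt b)]; rewrite // inE -(eq_semistandard E).
Qed.

End Skyline.

(* Main.v *)
(* Read a filling column by column, writing 0 for an empty position.  The
   semistandard conditions then only relate consecutive columns ([adjacent]),
   and the flag condition says exactly that the first column is adjacent to the
   basement column 1, 2, ..., n.  So the sum over SSF(alpha) is a transfer sum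
   along column sequences starting at the basement.

   Put p = r, q = r + 1 (numbered from 1, as in the paper).  Exchanging p and q
   in one column pairs the columns that contain p or q.  Running the transfer
   backwards from the empty column one finds, by comparing two consecutive
   columns only, that the sum over the two members of a pair is symmetric in
   x_p, x_q, and that the part of the member whose topmost letter among p, q is
   q is x_q times a symmetric polynomial.

   Let r be the first ascent.  In the first alpha_r columns the rows 1, ..., r+1
   carry their own index.  Interchanging rows r and r+1 to the right of these
   columns embeds SSF(alpha') into SSF(alpha) with the weights preserved, and the
   fillings that are missed are those with entry q in position
   (r+1, alpha_r + 1).  Hence, with G and G' the two generating functions,
   G is symmetric and G - G' is x_q times a symmetric polynomial, so that
   pi_r (G - G') = 0 and pi_r G' = pi_r G = G. *)

Require Import Defs.
From mathcomp Require Import all_boot all_order all_algebra all_fingroup.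
From mathcomp Require Import mpoly zify ring.

Set Implicit Arguments.
Unset Strict Implicit.
Unset Printing Implicit Defensive.

Import GRing.Theory.
Local Open Scope ring_scope.

(** * Columns, adjacency of consecutive columns, and the exchange of two letters *)

Section Columns.
Local Open Scope nat_scope.
Variable n : nat.
Implicit Types (c d : {ffun 'I_n -> 'I_n.+1}) (S : {set 'I_n}).

(** As 0 marks an empty position, the first clause gives left justification along with weak decrease
    in rows. In the second, [c k < d i] also forces the box to the right in row [i] to exist. *)
Definition adjacent c d : bool :=
  [forall i, d i <= c i] &&
  [forall i : 'I_n, forall k : 'I_n, [&& i < k, 0 < c k & c k < c i] ==> (c k < d i)].

Lemma adjacentP c d :
  reflect ((forall i, d i <= c i) /\
           (forall i k : 'I_n, i < k -> 0 < c k -> c k < c i -> c k < d i))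
          (adjacent c d).
Proof.
apply: (iffP andP) => -[H1 H2]; split.
- exact/forallP.
- move=> i k ik ck cki; move/forallP/(_ i)/forallP/(_ k)/implyP: H2; apply.
  by rewrite ik ck.
- exact/forallP.
- apply/forallP => i; apply/forallP => k; apply/implyP => /and3P[*].
  exact: H2.
Qed.

Definition valid S c : bool :=
  [forall i, (0 < c i) == (i \in S)] &&
  [forall i, forall k, (0 < c i) && (c i == c k) ==> (i == k)].

Lemma validP S c :
  reflect ((forall i, (0 < c i) = (i \in S)) /\
           (forall i k, 0 < c i -> c i = c k -> i = k))
          (valid S c).
Proof.
apply: (iffP andP) => -[H1 H2]; split.
- by move=> i; move/forallP/(_ i)/eqP: H1.
- move=> i k ci e; move/forallP/(_ i)/forallP/(_ k)/implyP: H2.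
  by rewrite ci e eqxx => /(_ isT)/eqP.
- by apply/forallP => i; rewrite H1.
- apply/forallP => i; apply/forallP => k; apply/implyP => /andP[ci /eqP e].
  by rewrite (H2 i k).
Qed.

Variable r : 'I_n.-1.

Definition swapv : {perm 'I_n.+1} :=
  tperm (lift ord0 (lo r)) (lift ord0 (hi r)).

Definition swapc c : {ffun 'I_n -> 'I_n.+1} := [ffun i => swapv (c i)].

Lemma swapcK : involutive swapc.
Proof. by move=> c; apply/ffunP => i; rewrite !ffunE tpermK. Qed.

Lemma swapcE c i :
  c i = r.+1 :> nat /\ swapc c i = r.+2 :> nat \/
  c i = r.+2 :> nat /\ swapc c i = r.+1 :> nat \/
  c i <> r.+1 :> nat /\ c i <> r.+2 :> nat /\ swapc c i = c i :> nat.
Proof.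
rewrite ffunE /swapv; case: tpermP => [->|->|E1 E2].
- by left; rewrite !lift0.
- by right; left; rewrite !lift0.
right; right; split=> [E|]; last split=> // E.
  by case: E1; apply: val_inj; rewrite /= E.
by case: E2; apply: val_inj; rewrite /= E.
Qed.

Lemma swapc_eq c i k : (swapc c i == swapc c k) = (c i == c k).
Proof. by rewrite !ffunE (inj_eq perm_inj). Qed.

Lemma swapc_gt0 c i : (0 < swapc c i) = (0 < c i).
Proof. by move: (swapcE c i); lia. Qed.

Lemma valid_swapc S c : valid S (swapc c) = valid S c.
Proof.
congr andb; first by apply: eq_forallb => i; rewrite swapc_gt0.
apply: eq_forallb => i; apply: eq_forallb => k.
by rewrite swapc_gt0 swapc_eq.
Qed.

(* The variables of [lo r] and [hi r] correspond to the entries r + 1 and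
   r + 2.  [top c] means that c has no such entry ([plain c]), or that its
   topmost one is r + 2. *)
Definition top c : bool :=
  [forall k, (c k == r.+1 :> nat) ==> [exists i : 'I_n, (i < k) && (c i == r.+2 :> nat)]].

Definition plain c : bool :=
  [forall i, (c i != r.+1 :> nat) && (c i != r.+2 :> nat)].

Lemma topP c :
  reflect (forall k, c k = r.+1 :> nat ->
             exists2 i : 'I_n, i < k & c i = r.+2 :> nat) (top c).
Proof.
apply: (iffP forallP) => H k.
- move=> /eqP E; move/implyP/(_ E)/existsP: (H k) => [i /andP[ik /eqP ei]].
  by exists i.
- apply/implyP => /eqP/H[i ik E]; apply/existsP; exists i.
  by rewrite ik E eqxx.
Qed.

Lemma plainP c :
  reflect (forall i, c i <> r.+1 :> nat /\ c i <> r.+2 :> nat) (plain c).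
Proof.
apply: (iffP forallP) => H i; first by case/andP: (H i) => /eqP ? /eqP ?.
by case: (H i) => /eqP -> /eqP ->.
Qed.

Lemma plain_swapc c : plain (swapc c) = plain c.
Proof.
apply: eq_forallb => i.
by move: (swapcE c i); lia.
Qed.

Lemma swapc_plain c : plain c -> swapc c = c.
Proof.
move=> /plainP H; apply/ffunP => i; apply: val_inj => /=.
by move: (swapcE c i) (H i); lia.
Qed.

Lemma plain_top c : plain c -> top c.
Proof. by move=> /plainP H; apply/topP => k E; case: (H k). Qed.

(** In a valid column each letter occurs at most once, so unless the column is plain the exchange
    changes which of the two letters is topmost. *)
Lemma top_swapc S c : valid S c -> top (swapc c) = plain c || ~~ top c.
Proof.
move=> /validP[_ D].
have [pc|npc] := boolP (plain c).
  by rewrite (swapc_plain pc) plain_top.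
apply/idP/idP => /=.
  move=> /topP H; apply/negP => /topP H'.
  case/negP: npc; apply/plainP => i0.
  suff Hp : forall k, c k <> r.+1 :> nat.
    split=> // E.
    have E2 : swapc c i0 = r.+1 :> nat by move: (swapcE c i0); lia.
    have [k _ Ek] := H i0 E2.
    by case: (Hp k); move: (swapcE c k); lia.
  move=> k Ek.
  have [i ik Ei] := H' k Ek.
  have Ei2 : swapc c i = r.+1 :> nat by move: (swapcE c i); lia.
  have [k' ik' Ek'] := H i Ei2.
  have Ek'2 : c k' = r.+1 :> nat by move: (swapcE c k'); lia.
  have := D k k' _ _; rewrite Ek => /(_ isT) F.
  have {}F : k = k' by apply: F; apply: val_inj; rewrite /= Ek Ek'2.
  by subst k'; lia.
move=> /topP NT; apply/topP => k Ek.
have Ek2 : c k = r.+2 :> nat by move: (swapcE c k); lia.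
have [i0 ik0 E0] : exists2 i : 'I_n, i < k & c i = r.+1 :> nat.
  have [/existsP[i /andP[ik /eqP E]]|/negP NE] :=
      boolP [exists i : 'I_n, (i < k) && (c i == r.+1 :> nat)].
    by exists i.
  case: NT => k' Ek'.
  exists k => //.
  have [lt|lt|/val_inj eq] := ltngtP k k' => //.
    by case: NE; apply/existsP; exists k'; rewrite lt Ek' eqxx.
  by subst k'; lia.
by exists i0 => //; move: (swapcE c i0); lia.
Qed.

(** The bounds [d i <= c i] and [c k < d i] cannot tell r + 1 from r + 2 in [d] when the entry of
    [c] differs from r + 1. *)
Lemma adjacent_swapcr c d :
  (forall i, c i <> r.+1 :> nat) -> adjacent c (swapc d) = adjacent c d.
Proof.
move=> H; suff {d} imp d : adjacent c d -> adjacent c (swapc d).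
  by apply/idP/idP => /imp //; rewrite swapcK.
move=> /adjacentP[H1 H2]; apply/adjacentP; split=> [i|i k ik k0 ki].
  by move: (swapcE d i) (H1 i) (H i); lia.
by move: (H2 i k ik k0 ki) (swapcE d i) (H k); lia.
Qed.

(** The only comparison that can change is r + 1 in [d] against r + 2 in [c]. Then [top d] puts r +
    2 in [d] higher up, where adjacency makes [c] exceed r + 2, and the clause on inversions fails
    there. *)
Lemma adjacent_swapc2 S c d :
    valid S c -> (forall i, c i <> r.+1 :> nat) -> top d ->
  adjacent (swapc c) (swapc d) = adjacent c d.
Proof.
move=> /validP[_ D] H /topP T.
have Dc (i k : 'I_n) : (i < k)%N -> c i = r.+2 :> nat -> c k <> r.+2 :> nat.
  move=> ik Ei Ek; have e : i = k; last by subst; lia.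
  by apply: D; [rewrite Ei | apply: val_inj; rewrite /= Ei Ek].
have sc i := swapcE c i; have sd i := swapcE d i.
apply/adjacentP/adjacentP => -[H1 H2]; split=> [i|i k ik k0 ki].
- move: (H1 i) (H i) (sc i) (sd i); lia.
- have k0' : 0 < swapc c k by rewrite swapc_gt0.
  have := H2 i k ik k0'.
  have [Ed|Ed] := eqVneq (d i : nat) r.+1; last first.
    move: (H i) (H k) (sc i) (sc k) (sd i) (Dc i k ik); lia.
  have [Ek|Ek] := eqVneq (c k : nat) r.+2; last first.
    move: (H i) (H k) (sc i) (sc k) (sd i); lia.
  have [k1 k1i E1] := T _ Ed.
  have k1k : k1 < k by lia.
  move: (H1 k1) (H2 k1 k k1k k0') (H k1) (sc k) (sc k1) (sd k1) (Dc k1 k k1k); lia.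
- move: (H1 i) (H i) (sc i) (sd i).
  have [Ed|Ed] := eqVneq (d i : nat) r.+1; last lia.
  have [k1 k1i E1] := T _ Ed.
  have [Ei|Ei] := eqVneq (c i : nat) r.+2; last lia.
  have i0 : 0 < c i by lia.
  move: (H1 k1) (H2 k1 i k1i i0) (H k1) (Dc k1 i k1i); lia.
- have k0' : 0 < c k by rewrite -swapc_gt0.
  have := H2 i k ik k0'.
  move: (H i) (H k) (sc i) (sc k) (sd i) (Dc i k ik); lia.
Qed.

(** * Columns that contain both letters, with r + 2 above r + 1 *)

Section Double.
Variables (S : {set 'I_n}) (c : {ffun 'I_n -> 'I_n.+1}).
Hypothesis vc : valid S c.
Variables (k1 k2 : 'I_n).
Hypotheses (k12 : k1 < k2) (ck1 : c k1 = r.+2 :> nat) (ck2 : c k2 = r.+1 :> nat).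

Lemma double_neq i : i <> k1 -> i <> k2 -> c i <> r.+1 :> nat /\ c i <> r.+2 :> nat.
Proof.
move=> n1 n2; have /validP[_ D] := vc; split=> E.
- by apply: n2; apply: D; [rewrite E | apply: val_inj; rewrite /= E ck2].
- by apply: n1; apply: D; [rewrite E | apply: val_inj; rewrite /= E ck1].
Qed.

(** The inversion of [c] at rows [k1], [k2] requires more than r + 1, and weak decrease allows at
    most r + 2. *)
Lemma double_adjacent d : adjacent c d -> d k1 = r.+2 :> nat.
Proof. move=> /adjacentP[/(_ k1) + /(_ k1 k2 k12)]; lia. Qed.

(** Adjacency would put r + 1 in row [k1] of [d], hence by [top] r + 2 in a higher row, which the
    exchange turns into r + 1. There [c] exceeds r + 2, and the inversion with row [k1] requires
    more than r + 2. *)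
Lemma double_not_adjacent d : top d -> ~~ adjacent c (swapc d).
Proof.
move=> /topP T; apply/negP => A.
have E : swapc d k1 = r.+2 :> nat.
  by move/adjacentP: A => [/(_ k1) + /(_ k1 k2 k12)]; lia.
have Ed : d k1 = r.+1 :> nat by move: (swapcE d k1); lia.
have [k0 k01 E0] := T _ Ed.
have n1 : k0 <> k1 by move=> e; subst; lia.
have n2 : k0 <> k2 by move=> e; subst; lia.
have /adjacentP[H1 H2] := A.
move: (H1 k0) (H2 k0 k1 k01) (double_neq n1 n2) (swapcE d k0); lia.
Qed.

(** Together with [double_not_adjacent], this count makes [d] and [swapc d] occur equally often
    after the pair [c], [swapc c]. *)
Lemma double_adjacent_swapc2 S' d : valid S' d -> top d ->
  (adjacent (swapc c) (swapc d) : nat) = adjacent c d + adjacent (swapc c) d.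
Proof.
move=> /validP[_ Dd] /topP T.
have nE (i k : 'I_n) : (i < k)%N -> i <> k by move=> ik e; subst; lia.
have sc i := swapcE c i; have sd i := swapcE d i.
have dn i := @double_neq i.
have row_cases i : [\/ i = k1, i = k2 | i <> k1 /\ i <> k2].
  have [->|/eqP ?] := eqVneq i k1; first by apply: Or31.
  by have [->|/eqP ?] := eqVneq i k2; [apply: Or32|apply: Or33].
have Dd2 (i : 'I_n) : i <> k1 -> d k1 = r.+2 :> nat -> d i <> r.+2 :> nat.
  move=> ne E1 Ei; apply: ne; apply: Dd; first by rewrite Ei.
  by apply: val_inj; rewrite /= E1 Ei.
(* [c] forces r + 2 in row [k1] of [d], which exceeds the r + 1 of [swapc c]. *)
have excl : adjacent c d -> ~~ adjacent (swapc c) d.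
  move=> /double_adjacent E; apply/negP => /adjacentP[/(_ k1) + _].
  move: (sc k1); lia.
have to1 : adjacent c d -> adjacent (swapc c) (swapc d).
  move=> A; have E := double_adjacent A; have /adjacentP[H1 H2] := A.
  apply/adjacentP; split=> [i|i k ik].
    case: (row_cases i) => [->|->|[i1 i2]].
    - move: (sc k1) (sd k1); lia.
    - move: (sc k2) (sd k2) (H1 k2); lia.
    - move: (sc i) (sd i) (H1 i) (dn i i1 i2); lia.
  rewrite swapc_gt0 => k0; have := H2 i k ik k0.
  case: (row_cases k) (row_cases i) => [?|?|[n1 n2]] [?|?|[i1 i2]]; subst; try lia.
  - move: (sc k1) (sc i) (sd i) (dn i i1 i2); lia.
  - move: (sc k1) (sc k2); lia.
  - move: (sc k2) (sc i) (sd i) (dn i i1 i2) (Dd2 i i1 E); lia.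
  - move: (sc k) (sc k1) (sd k1) (dn k n1 n2); lia.
  - move: (sc k) (sc k2) (sd k2) (dn k n1 n2); lia.
  - move: (sc k) (sc i) (sd i) (dn k n1 n2) (dn i i1 i2); lia.
have to2 : adjacent (swapc c) d -> adjacent (swapc c) (swapc d).
  move=> /adjacentP[H1 H2].
  (* In a row above [k1] such an entry would stand beside a larger entry of [swapc c], whose
     inversion with the r + 2 in row [k2] requires more than r + 2. *)
  have first_hi i : d i = r.+2 :> nat -> k1 <= i.
    move=> Ei; rewrite leqNgt; apply/negP => lt.
    have ik2 : i < k2 by lia.
    have n1 := nE _ _ lt; have n2 := nE _ _ ik2.
    move: (H1 i) (H2 i k2 ik2) (sc i) (sc k2) (dn i n1 n2).
    rewrite swapc_gt0; lia.
  have dk1 : d k1 <> r.+1 :> nat.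
    by move=> /T[i ik /first_hi]; lia.
  have no_lo (i : 'I_n) : i < k1 -> d i <> r.+1 :> nat.
    by move=> ik1 /T[j ji /first_hi]; lia.
  apply/adjacentP; split=> [i|i k ik].
    case: (row_cases i) => [->|->|[i1 i2]].
    - move: (sc k1) (sd k1) (H1 k1); lia.
    - move: (sc k2) (sd k2) (H1 k2); lia.
    - move: (sc i) (sd i) (H1 i) (dn i i1 i2); lia.
  move=> k0; have := H2 i k ik k0.
  case: (row_cases k) => [?|?|[n1 n2]]; subst.
  - move: (sc k1) (sd i) (first_hi i); lia.
  - move: (sc k2) (sd i); lia.
  - move: (sc k) (sd i) (dn k n1 n2); lia.
have from : adjacent (swapc c) (swapc d) -> adjacent c d || adjacent (swapc c) d.
  move=> /adjacentP[H1 H2].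
  have H2' (i k : 'I_n) : i < k -> 0 < c k -> swapc c k < swapc c i ->
      swapc c k < swapc d i.
    by move=> ? ?; apply: H2; rewrite ?swapc_gt0.
  (* Row [k1] of [d] tells which adjacency holds: the one from [c] when it carries r + 2, otherwise
     the one from [swapc c]. *)
  have [E|E] := eqVneq (d k1 : nat) r.+2.
    have no_lo (i : 'I_n) : i < k1 -> d i <> r.+1 :> nat.
      move=> ik1 /T[j ji Ej].
      have lt : j < k1 by lia.
      by case: (Dd2 j (nE _ _ lt) E).
    apply/orP; left; apply/adjacentP; split=> [i|i k ik k0].
      case: (row_cases i) => [->|->|[i1 i2]].
      - lia.
      - move: (sc k2) (sd k2) (H1 k2) (Dd2 k2 (nesym (nE _ _ k12)) E); lia.
      - move: (sc i) (sd i) (H1 i) (dn i i1 i2); lia.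
    have := H2' i k ik k0.
    case: (row_cases k) (row_cases i) => [?|?|[n1 n2]] [?|?|[i1 i2]]; subst; try lia.
    - move: (sc k1) (sc i) (sd i) (dn i i1 i2) (no_lo i ik); lia.
    - move: (sc k2) (sc i) (sd i) (dn i i1 i2); lia.
    - move: (sc k) (sc k2) (sd k2) (dn k n1 n2); lia.
    - move: (sc k) (sc i) (sd i) (dn k n1 n2) (dn i i1 i2); lia.
  have first_hi i : d i = r.+2 :> nat -> k1 <= i.
    move=> Ei; rewrite leqNgt; apply/negP => lt.
    have ik2 : i < k2 by lia.
    have n1 := nE _ _ lt; have n2 := nE _ _ ik2.
    have k20 : 0 < c k2 by lia.
    move: (H1 i) (H2' i k2 ik2 k20) (sc i) (sd i) (sc k2) (dn i n1 n2); lia.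
  apply/orP; right; apply/adjacentP; split=> [i|i k ik].
    case: (row_cases i) => [->|->|[i1 i2]].
    - move: (sc k1) (sd k1) (H1 k1); lia.
    - move: (sc k2) (sd k2) (H1 k2); lia.
    - move: (sc i) (sd i) (H1 i) (dn i i1 i2); lia.
  rewrite swapc_gt0 => k0; have := H2' i k ik k0.
  case: (row_cases k) => [?|?|[n1 n2]]; subst.
  - have [Ed|Ed] := eqVneq (d i : nat) r.+1.
      by have [j ji /first_hi] := T _ Ed; lia.
    move: (sc k1) (sd i); lia.
  - move: (sc k2) (sd i); lia.
  - move: (sc k) (sd i) (dn k n1 n2); lia.
case: (boolP (adjacent c d)) => [/[dup]/to1-> /excl/negbTE->//|nA].
case: (boolP (adjacent (swapc c) d)) => [/to2->//|nA'].
by apply/eqP; rewrite eqb0; apply/negP => /from; rewrite (negbTE nA) (negbTE nA').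
Qed.

End Double.

End Columns.


(** * Transfer sums over column sequences and their symmetry in two variables *)

Lemma single_pair_identity (R : comNzRingType) (h l w y z : R) (a b : nat) :
  h * w * (y *+ a + z *+ a) + l * w * (y *+ b + z *+ a)
  = (h + l) * w * ((y + z) *+ a) + w * (l * y) *+ b - w * (l * y) *+ a.
Proof. ring. Qed.

Section Transfer.
Variables (n : nat) (r : 'I_n.-1).
Implicit Types (c d : {ffun 'I_n -> 'I_n.+1}) (S : {set 'I_n}) (f g : {mpoly int[n]}).

(* The entry 0 stands for an empty position, hence has weight 1. *)
Definition xval (v : 'I_n.+1) : {mpoly int[n]} :=
  oapp (fun k => 'X_k) 1 (unlift ord0 v).

Definition xcol c : {mpoly int[n]} := \prod_i xval (c i).

(** A transfer sum over the columns to the right of [c]. The weight of [c] is left to [total], so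
    that [c] may also be the basement, which carries no weight. *)
Fixpoint tails (s : seq {set 'I_n}) c : {mpoly int[n]} :=
  if s is U :: s' then
    \sum_(d | valid U d && adjacent c d) xcol d * tails s' d
  else 1.

Definition total s c := xcol c * tails s c.

Definition swapinv f := msym (swap r) f = f.

Lemma swapinv0 : swapinv 0. Proof. exact: msym0. Qed.

Lemma swapinvD f g : swapinv f -> swapinv g -> swapinv (f + g).
Proof. by rewrite /swapinv msymD => -> ->. Qed.

Lemma swapinvB f g : swapinv f -> swapinv g -> swapinv (f - g).
Proof. by rewrite /swapinv msymB => -> ->. Qed.

Lemma swapinvM f g : swapinv f -> swapinv g -> swapinv (f * g).
Proof. by rewrite /swapinv msymM => -> ->. Qed.

Lemma swapinvMn f k : swapinv f -> swapinv (f *+ k).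
Proof. by rewrite /swapinv msymMn => ->. Qed.

Lemma swapinv_sum (I : Type) (s : seq I) (P : pred I) (F : I -> {mpoly int[n]}) :
  (forall i, P i -> swapinv (F i)) -> swapinv (\sum_(i <- s | P i) F i).
Proof. by move=> H; apply: big_ind => //; [exact: swapinv0|exact: swapinvD]. Qed.

Lemma msym_var k : msym (swap r) 'X_k = 'X_(swap r k) :> {mpoly int[n]}.
Proof. by rewrite /msym mmapX mmap1U. Qed.

Lemma msym_xval v : msym (swap r) (xval v) = xval (swapv r v).
Proof.
rewrite /xval; case: unliftP => [k|] ->.
  rewrite /= msym_var /swapv -inj_tperm; last exact: lift_inj.
  by rewrite liftK.
rewrite /swapv tpermD ?unlift_none /= ?msym1 //; exact: neq_lift.
Qed.

Lemma msym_xcol c : msym (swap r) (xcol c) = xcol (swapc r c).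
Proof.
rewrite /xcol rmorph_prod; apply: eq_bigr => i _.
by rewrite /= msym_xval ffunE.
Qed.

Notation xlo := ('X_(lo r) : {mpoly int[n]}).
Notation xhi := ('X_(hi r) : {mpoly int[n]}).

Lemma swapinv_e1 : swapinv (xhi + xlo).
Proof. by rewrite /swapinv msymD !msym_var tpermL tpermR addrC. Qed.

Lemma swapinv_e2 : swapinv (xlo * xhi).
Proof. by rewrite /swapinv msymM !msym_var tpermL tpermR mulrC. Qed.

Lemma xval_lo (v : 'I_n.+1) : v = r.+1 :> nat -> xval v = xlo.
Proof.
move=> E; rewrite (_ : v = lift ord0 (lo r)) /xval ?liftK //.
by apply: val_inj; rewrite /= E.
Qed.

Lemma xval_hi (v : 'I_n.+1) : v = r.+2 :> nat -> xval v = xhi.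
Proof.
move=> E; rewrite (_ : v = lift ord0 (hi r)) /xval ?liftK //.
by apply: val_inj; rewrite /= E.
Qed.

Lemma xcol_single S c i :
    valid S c -> (forall k, c k <> r.+1 :> nat) -> c i = r.+2 :> nat ->
  exists w, [/\ swapinv w, xcol c = xhi * w & xcol (swapc r c) = xlo * w].
Proof.
move=> /validP[_ D] nlo ci; exists (\prod_(k | k != i) xval (c k)).
have nhi k : k != i -> swapc r c k = c k.
  move=> ki; apply: val_inj; move: (swapcE r c k) (nlo k) => /= H H'.
  have : c k <> r.+2 :> nat; last by lia.
  move=> E; case/eqP: ki; apply: D; first by rewrite E.
  by apply: val_inj; rewrite /= E ci.
split.
- rewrite /swapinv rmorph_prod; apply: eq_bigr => k /nhi /=.
  by rewrite msym_xval ffunE => ->.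
- by rewrite /xcol (bigD1 i) //= xval_hi.
rewrite /xcol (bigD1 i) //= xval_lo; last by move: (swapcE r c i); lia.
by congr (_ * _); apply: eq_bigr => k /nhi ->.
Qed.

(** Exchanging the letters amounts to exchanging rows [i] and [k], which only permutes the
    factors. *)
Lemma xcol_double S c i k :
    valid S c -> c i = r.+2 :> nat -> c k = r.+1 :> nat ->
  xcol (swapc r c) = xcol c.
Proof.
move=> /validP[_ D] ci ck.
have neq j l : c l <> 0 :> nat -> j != l -> c j <> c l :> nat.
  move=> l0 /eqP jl E; apply: jl; apply: D; [lia | exact: val_inj].
rewrite /xcol [RHS](reindex_inj (@perm_inj _ (tperm i k))); apply: eq_bigr => j _.
congr xval; apply: val_inj => /=; move: (swapcE r c j).
case: tpermP => [->|->|/eqP ji /eqP jk]; try lia.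
have := neq j i; have := neq j k; rewrite ji jk ci ck; lia.
Qed.

(** Each column is paired with its exchange and the pair is indexed by its [top] member; a plain
    column is its own partner and is counted once. *)
Lemma sum_valid S (E : {ffun 'I_n -> 'I_n.+1} -> {mpoly int[n]}) :
  \sum_(d | valid S d) E d =
  \sum_(d | valid S d && top r d)
     (E d + (if plain r d then 0 else E (swapc r d))).
Proof.
rewrite (bigID (top r)) /= big_split /=; congr (_ + _).
under [X in _ = X]eq_bigr do rewrite -if_neg.
rewrite -big_mkcondr (reindex_inj (inv_inj (@swapcK _ r))) /=.
apply: eq_bigl => d; rewrite valid_swapc -andbA; case vd: (valid S d) => //=.
rewrite (top_swapc r vd) negb_or negbK andbC.
by case: (top r d).
Qed.

Lemma tails_cons S s c :
  tails (S :: s) c = \sum_(d | valid S d) total s d *+ adjacent c d.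
Proof.
rewrite /= big_mkcondr /=; apply: eq_bigr => d _.
by case: ifP; rewrite ?mulr1n.
Qed.

Lemma tails_top S s c :
  tails (S :: s) c = \sum_(d | valid S d && top r d)
    (total s d *+ adjacent c d +
     if plain r d then 0 else total s (swapc r d) *+ adjacent c (swapc r d)).
Proof. by rewrite tails_cons sum_valid. Qed.

(* That [total s c] is x_{hi} times a symmetric polynomial is stated without a
   division: its product with x_{lo} is symmetric. *)
Lemma total_inv s S c :
    last S s = set0 -> valid S c -> top r c ->
  swapinv (total s c + (if plain r c then 0 else total s (swapc r c))) /\
  (~~ plain r c -> swapinv (xlo * total s c)).
Proof.
elim: s S c => [|S' s IH] S c /= lastS vc tc.
  (* The last support is empty, so the last column has no entries. *)
  have pc : plain r c.
    apply/plainP => i; have /validP[/(_ i)] := vc.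
    rewrite lastS inE; lia.
  rewrite pc /total /= mulr1 addr0; split=> //.
  by rewrite /swapinv msym_xcol swapc_plain.
have {}IH d := IH S' d lastS.
pose P d := total s d + (if plain r d then 0 else total s (swapc r d)).
have IH1 d : valid S' d -> top r d -> swapinv (P d).
  by move=> vd td; case: (IH d vd td).
have IH2 d : valid S' d -> top r d -> ~~ plain r d -> swapinv (xlo * total s d).
  by move=> vd td; case: (IH d vd td).
(* Without r + 1 in [c], either both members of a pair may follow [c] or neither. *)
have nolo_tails : (forall k, c k <> r.+1 :> nat) -> swapinv (tails (S' :: s) c).
  move=> nlo; rewrite tails_top; apply: swapinv_sum => d /andP[vd td].
  have := IH1 d vd td; rewrite /P (adjacent_swapcr d nlo).
  by case: ifP => _ iP; rewrite ?addr0 -?mulrnDl in iP *; apply: swapinvMn.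
have [pc|npc] := boolP (plain r c).
  split=> //; rewrite addr0; apply: swapinvM.
    by rewrite /swapinv msym_xcol swapc_plain.
  by apply: nolo_tails => k; have /plainP/(_ k)[] := pc.
have [/existsP[k2 /eqP ck2]|/existsPn nlo] :=
    boolP [exists k, c k == r.+1 :> nat].
  (* Both letters occur: the weight is symmetric, and [d], [swapc r d] enter the sum with equal
     multiplicity. *)
  have [k1 k12 ck1] := topP _ _ tc _ ck2.
  have W := xcol_double vc ck1 ck2.
  have iW : swapinv (xcol c) by rewrite /swapinv msym_xcol W.
  rewrite /total W -mulrDr !tails_top -big_split /=; split=> [|_].
    apply: swapinvM => //; apply: swapinv_sum => d /andP[vd td].
    have nA := double_not_adjacent vc k12 ck1 ck2 td.
    have := double_adjacent_swapc2 vc k12 ck1 ck2 vd td.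
    have := IH1 d vd td; rewrite /P; case: ifP => [pd|npd] iP.
      move: nA; rewrite (swapc_plain pd) => /negbTE-> _.
      by rewrite !addr0 add0r in iP *; apply: swapinvMn.
    move=> E; rewrite (negbTE nA) mulr0n addr0 E addrA -mulrnDr -mulrnDl.
    exact: swapinvMn.
  (* After [c] alone only [top] columns that are not plain survive, so the induction hypothesis
     applies termwise. *)
  rewrite mulrCA; apply: swapinvM => //; rewrite mulr_sumr.
  apply: swapinv_sum => d /andP[vd td].
  have nA := double_not_adjacent vc k12 ck1 ck2 td.
  case: ifP => [pd|npd].
    move: nA; rewrite (swapc_plain pd) => /negbTE->.
    by rewrite addr0 mulr0; apply: swapinv0.
  rewrite (negbTE nA) addr0 mulrnAr; apply: swapinvMn; apply: IH2 => //.
  by rewrite npd.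
have {}nlo k : c k <> r.+1 :> nat by apply/eqP.
have [i ci] : exists i, c i = r.+2 :> nat.
  case/forallPn: npc => i; rewrite negb_and !negbK => /orP[/eqP/nlo//|/eqP].
  by exists i.
have [w [iw Wc Wc']] := xcol_single vc nlo ci.
split=> [|_]; last first.
  rewrite /total Wc !mulrA.
  by do 2?apply: swapinvM => //; [exact: swapinv_e2|exact: nolo_tails].
rewrite /total Wc Wc' !tails_top !mulr_sumr -big_split /=.
apply: swapinv_sum => d /andP[vd td].
have A2 := adjacent_swapc2 vc nlo td; rewrite A2 (adjacent_swapcr d nlo).
have := IH1 d vd td; have := IH2 d vd td; rewrite /P; case: ifP => [pd _ iP|npd].
  move: A2; rewrite (swapc_plain pd) => ->; rewrite !addr0 in iP *.
  rewrite -mulrDl -mulrDl; apply: swapinvM; last exact: swapinvMn.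
  by apply: swapinvM => //; exact: swapinv_e1.
move=> /(_ isT) i2 i1.
(* The terms are regrouped into symmetric pieces: the sum of the two variables, [w], the pair sum of
   [d], and [xlo * total s d]. *)
rewrite single_pair_identity.
apply: swapinvB; last by apply: swapinvMn; apply: swapinvM.
apply: swapinvD; last by apply: swapinvMn; apply: swapinvM.
by apply: swapinvM; [apply: swapinvM => //; exact: swapinv_e1|exact: swapinvMn].
Qed.

End Transfer.

(** * Exchange of two rows, and comparison of the two shapes at the first ascent *)

Section Ascent.
Variables (n : nat) (r : 'I_n.-1).
Implicit Types (c d : {ffun 'I_n -> 'I_n.+1}) (S : {set 'I_n}).

Definition swapr c : {ffun 'I_n -> 'I_n.+1} := [ffun i => c (swap r i)].
Definition swapS S : {set 'I_n} := [set i | swap r i \in S].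

Lemma swaprK : involutive swapr.
Proof. by move=> c; apply/ffunP => i; rewrite !ffunE /swap tpermK. Qed.

Lemma swapE (i : 'I_n) :
  [\/ i = lo r /\ swap r i = hi r, i = hi r /\ swap r i = lo r
    | i <> r :> nat /\ i <> r.+1 :> nat /\ swap r i = i].
Proof.
rewrite /swap; case: tpermP => [->|->|ilo ihi].
- exact: Or31.
- exact: Or32.
by apply: Or33; split; [|split=> //] => E; [case: ilo|case: ihi]; apply: val_inj.
Qed.

Lemma swap_lt (i k : 'I_n) :
  (i < k)%N -> i = lo r /\ k = hi r \/ (swap r i < swap r k)%N.
Proof.
case: (swapE i) (swapE k) => [[-> ->]|[-> ->]|[i1 [i2 ->]]]
    [[-> ->]|[-> ->]|[k1 [k2 ->]]] /= ik; try (by left); right; lia.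
Qed.

Lemma valid_swapr S d : valid (swapS S) (swapr d) = valid S d.
Proof.
suff {S d} imp S d : valid S d -> valid (swapS S) (swapr d).
  apply/idP/idP => /imp //; rewrite swaprK.
  by rewrite (_ : swapS (swapS S) = S) //; apply/setP => i; rewrite !inE /swap tpermK.
move=> /validP[V D]; apply/validP; split=> [i|i k]; first by rewrite ffunE V inE.
by rewrite !ffunE => i0 /(D _ _ i0) /perm_inj.
Qed.

Lemma xcol_swapr d : xcol (swapr d) = xcol d.
Proof.
rewrite /xcol [RHS](reindex_inj (@perm_inj _ (swap r))).
by apply: eq_bigr => i _; rewrite ffunE.
Qed.

(** By [swap_lt] only the pair [lo r], [hi r] changes order, and an inversion needs both of its
    positions filled. *)
Lemma adjacent_swapr c d :
  c (lo r) = 0 :> nat -> adjacent (swapr c) (swapr d) = adjacent c d.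
Proof.
move=> c0; apply/adjacentP/adjacentP => -[H1 H2]; split.
- by move=> i; have := H1 (swap r i); rewrite !ffunE /swap !tpermK.
- move=> i k ik k0 ki; have [[Ei _]|lt] := swap_lt ik.
    by move: ki; rewrite Ei c0.
  by have := H2 _ _ lt; rewrite !ffunE /swap !tpermK; apply.
- by move=> i; rewrite !ffunE; apply: H1.
move=> i k ik; rewrite !ffunE; have [[Ei ->]|lt] := swap_lt ik; last exact: H2.
by rewrite /swap tpermR c0.
Qed.

Lemma tails_swapr s c :
  c (lo r) = 0 :> nat -> tails (map swapS s) (swapr c) = tails s c.
Proof.
elim: s c => [//|S s IH] c c0 /=.
rewrite (reindex_inj (inv_inj swaprK)) /=.
apply: eq_big => [d|d /andP[_]]; first by rewrite valid_swapr adjacent_swapr.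
rewrite adjacent_swapr // => /adjacentP[H1 _].
rewrite xcol_swapr IH //; have := H1 (lo r); lia.
Qed.

Definition stair c := forall i : 'I_n, (i <= r.+1)%N -> c i = i.+1 :> nat.

(** Moving the entry of row [hi r] up places it beside r + 1 instead of r + 2, whence the extra
    bound. Either adjacency makes the entries of [c] below row [lo r] empty or at least r + 2, so
    neither row starts an inversion. *)
Lemma stair_adjacent_swapr S c d : valid S c -> stair c -> d (lo r) = 0 :> nat ->
  adjacent c (swapr d) = adjacent c d && (d (hi r) <= r.+1)%N.
Proof.
move=> /validP[_ D] st d0.
have clo : c (lo r) = r.+1 :> nat by apply: st => /=; lia.
have chi : c (hi r) = r.+2 :> nat by apply: st => /=; lia.
have Dlo (k : 'I_n) : (r < k)%N -> c k <> r.+1 :> nat.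
  move=> rk E; have e : k = lo r; last by move: rk; rewrite e /=; lia.
  by apply: D; [rewrite E | apply: val_inj; rewrite /= E clo].
have slo : swapr d (lo r) = d (hi r) by rewrite ffunE /swap tpermL.
have shi : swapr d (hi r) = 0 :> nat by rewrite ffunE /swap tpermR.
apply/adjacentP/andP => [[H1 H2]|[/adjacentP[H1 H2] dhi]].
  have below (k : 'I_n) : (hi r < k)%N -> (0 < c k)%N -> (r.+2 <= c k)%N.
    by move=> hk k0; have := H2 _ _ hk k0; rewrite shi chi; lia.
  split; last by have := H1 (lo r); rewrite slo clo.
  apply/adjacentP; split=> [i|i k ik k0].
    case: (swapE i) => [[-> _]|[-> _]|[i1 [i2 Ei]]].
    - by rewrite d0.
    - by have := H1 (lo r); rewrite slo clo chi; lia.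
    - by have := H1 i; rewrite ffunE Ei.
  case: (swapE i) => [[Ei _]|[Ei _]|[i1 [i2 Ei]]].
  - rewrite Ei clo; have [Ek|nk] := eqVneq (k : nat) r.+1.
      by rewrite (_ : k = hi r) ?chi; [lia|exact: val_inj].
    by have := below k; rewrite Ei /= in ik *; lia.
  - by rewrite Ei chi; have := below k; rewrite Ei /= in ik *; lia.
  - by have := H2 i k ik k0; rewrite ffunE Ei.
have below (k : 'I_n) : (r < k)%N -> (0 < c k)%N -> (r.+2 <= c k)%N.
  move=> rk k0; have := H2 (lo r) k rk k0; rewrite clo d0.
  by have := Dlo k rk; lia.
split=> [i|i k ik k0].
  case: (swapE i) => [[-> _]|[-> _]|[i1 [i2 Ei]]].
  - by rewrite slo clo.
  - by rewrite shi.
  - by rewrite ffunE Ei.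
case: (swapE i) => [[Ei _]|[Ei _]|[i1 [i2 Ei]]].
- by rewrite Ei clo; have := below k; rewrite Ei /= in ik *; lia.
- by rewrite Ei chi; have := below k; rewrite Ei /= in ik *; lia.
- by rewrite ffunE Ei; exact: H2.
Qed.

(** By induction on the row: weak decrease bounds the entry, and every smaller value is already used
    higher up. *)
Lemma stair_next S c d : (forall i : 'I_n, (i <= r.+1)%N -> i \in S) ->
  stair c -> valid S d -> adjacent c d -> stair d.
Proof.
move=> sS st /validP[V D] /adjacentP[H1 _] i ir.
elim/ltn_ind: {i}(i : nat) {-2}i (erefl (i : nat)) ir => j IH i Ei ir.
have i0 : (0 < d i)%N by rewrite V sS.
have := H1 i; rewrite st // leq_eqVlt => /orP[/eqP//|lt].
have vn : ((d i).-1 < n)%N by have := ltn_ord i; lia.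
pose v := Ordinal vn.
have Ev : d v = v.+1 :> nat by apply: (IH v) => //=; lia.
have : i = v by apply: D => //; apply: val_inj; rewrite /= Ev /=; lia.
by move=> /(congr1 val) /=; lia.
Qed.

Lemma swapinv_xcol_stair S c : valid S c -> stair c -> swapinv r (xcol c).
Proof.
move=> vc st; rewrite /swapinv msym_xcol (@xcol_double _ _ S _ (hi r) (lo r)) //.
- by apply: st => /=; lia.
- by apply: st => /=; lia.
Qed.

Variable alpha : 'I_n -> nat.
Hypothesis r_first_ascent : first_ascent alpha r.

Definition support (beta : 'I_n -> nat) j : {set 'I_n} := [set i | (j < beta i)%N].
Definition supports beta j k := [seq support beta l | l <- iota j k].

Notation a := (alpha (lo r)).

Lemma ascent_lt : (a < alpha (hi r))%N.
Proof. by case/andP: r_first_ascent. Qed.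

Lemma ascent_le (i : 'I_n) : (i <= r)%N -> (a <= alpha i)%N.
Proof.
have /andP[/forallP H _] := r_first_ascent.
move=> ir; elim: {i}(r - i)%N {-2}i (erefl (r - i)%N) ir => [|e IH] i Ei ir.
  by rewrite (_ : lo r = i) //; apply: val_inj => /=; lia.
have lt : (i < n.-1)%N by have := ltn_ord r; lia.
pose k := Ordinal lt.
have /implyP := H k; rewrite (_ : lo k = i); last exact: val_inj.
by move=> Hk; apply: leq_trans (Hk _); [apply: IH => /=; lia | move=> /=; lia].
Qed.

Lemma support_swapr j : support (alpha \o swap r) j = swapS (support alpha j).
Proof. by apply/setP => i; rewrite !inE. Qed.

Lemma supports_swapr j k :
  supports (alpha \o swap r) j k = map swapS (supports alpha j k).
Proof. by rewrite /supports -map_comp; apply: eq_map => l; exact: support_swapr. Qed.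

Lemma support_swapr_lt j : (j < a)%N ->
  support (alpha \o swap r) j = support alpha j.
Proof.
move=> ja; have jh := ltn_trans ja ascent_lt.
apply/setP => i; rewrite !inE /=.
by case: (swapE i) => [[-> ->]|[-> ->]|[_ [_ ->]]] //; rewrite ja jh.
Qed.

(** The list runs one column past the longest possible row; this empty column starts the backward
    induction in [total_inv]. *)
Lemma last_supports m j k S : (forall i, alpha i <= m)%N -> (j + k = m)%N ->
  last S (supports alpha j k.+1) = set0.
Proof.
move=> am jk; rewrite /supports -(addn1 k) iotaD map_cat last_cat /= jk.
by apply/setP => i; rewrite !inE ltnNge am.
Qed.

(** Backward induction from column [a], the first without row [lo r]; before it both shapes have the
    same supports and the columns are stairs. The second conclusion says, without division, that the
    difference is x_{hi} times a symmetric polynomial. *)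
Lemma stair_inv m S c j k :
    (forall i, alpha i <= m)%N -> (j + k = m)%N -> (j <= a)%N ->
    valid S c -> stair c ->
  swapinv r (total (supports alpha j k.+1) c) /\
  swapinv r ('X_(lo r) * (tails (supports alpha j k.+1) c -
                      tails (supports (alpha \o swap r) j k.+1) c)).
Proof.
move=> am.
elim: {j}(a - j)%N {-2}j (erefl (a - j)%N) k S c
  => [|e IH] j Ej k S c jk ja vc st.
  have {Ej ja} ja : j = a by lia.
  have clo : c (lo r) = r.+1 :> nat by apply: st => /=; lia.
  have chi : c (hi r) = r.+2 :> nat by apply: st => /=; lia.
  have U0 (d : {ffun 'I_n -> 'I_n.+1}) : valid (support alpha j) d -> d (lo r) = 0 :> nat.
    by move=> /validP[/(_ (lo r)) + _]; rewrite inE ja ltnn; lia.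
  have ls := last_supports S am jk.
  have klt : exists k', k = k'.+1.
    by exists k.-1; have := am (hi r); have := ascent_lt; lia.
  split.
    have npc : ~~ plain r c by apply/negP => /plainP/(_ (lo r)); rewrite clo => -[].
    (* In [c] the letter r + 1 is above r + 2, so [swapc r c] is the [top] member of the pair. Its
       total vanishes, since it would force r + 2 into the empty row [lo r]. *)
    have tsc : top r (swapc r c).
      rewrite (top_swapc r vc); apply/orP; right; apply/negP => /topP/(_ _ clo)[i /= il].
      by rewrite st; lia.
    have := total_inv ls _ tsc; rewrite valid_swapc plain_swapc (negbTE npc) swapcK.
    move=> /(_ vc)[+ _]; suff -> : total (supports alpha j k.+1) (swapc r c) = 0.
      by rewrite add0r.
    rewrite /total /= big_pred0 ?mulr0 // => d; apply/negP => /andP[/U0 d0 A].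
    have v : valid S (swapc r c) by rewrite valid_swapc.
    have := double_adjacent v (k1 := lo r) (k2 := hi r) _ _ _ A.
    move: (swapcE r c (lo r)) (swapcE r c (hi r)); rewrite d0 clo chi /=.
    move=> H1 H2 /(_ r); lia.
  case: klt => k' Ek'.
  have lk : (j.+1 + k' = m)%N by lia.
  rewrite -[supports _ j k.+1]/(support alpha j :: supports alpha j.+1 k).
  rewrite supports_swapr.
  rewrite -[supports _ j k.+1]/(support alpha j :: supports alpha j.+1 k).
  set s := supports alpha j.+1 k.
  rewrite [X in _ - X]/= (reindex_inj (inv_inj swaprK)) /=.
  (* By [stair_adjacent_swapr], the swapped shape accounts for the columns with at most r + 1 in row
     [hi r]; those with r + 2 there remain. *)
  rewrite [X in _ - X](_ : _ =
    \sum_(d | (valid (support alpha j) d && adjacent c d) &&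
              (d (hi r) <= r.+1)%N) total s d).
    rewrite (bigID (fun d : {ffun 'I_n -> 'I_n.+1} => d (hi r) <= r.+1)%N) /=.
    rewrite addrAC subrr add0r mulr_sumr; apply: swapinv_sum => d /andP[/andP[vd A] dhi].
    have d0 := U0 d vd.
    have Ed : d (hi r) = r.+2 :> nat.
      by have /adjacentP[/(_ (hi r)) + _] := A; rewrite chi; lia.
    have npd : ~~ plain r d by apply/negP => /plainP/(_ (hi r)); rewrite Ed => -[].
    (* No r + 1 lies above row [hi r]: row [lo r] is empty, and the stair bounds the rows above
       it. *)
    have tpd : top r d.
      apply/topP => i Ei; exists (hi r) => //; rewrite ltnNge; apply/negP => /= ih.
      have [E|ne] := eqVneq (i : nat) r.+1.
        by move: Ei; rewrite (_ : i = hi r) ?Ed; [lia|exact: val_inj].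
      have [E|ne'] := eqVneq (i : nat) r.
        by move: Ei; rewrite (_ : i = lo r) ?d0; [lia|exact: val_inj].
      have /adjacentP[/(_ i) + _] := A; rewrite st //; lia.
    have ls' : last (support alpha j) s = set0.
      by rewrite /s Ek'; apply: last_supports am lk.
    by have [_ H] := total_inv ls' vd tpd; exact: H.
  apply: eq_big => [d|d /andP[]].
    rewrite valid_swapr; case vd: (valid _ _) => //=.
    by rewrite (stair_adjacent_swapr vc st (U0 d vd)).
  rewrite valid_swapr => vd _.
  by rewrite xcol_swapr tails_swapr // U0.
have {}ja : (j < a)%N by lia.
have [k' Ek'] : exists k', k = k'.+1.
  by exists k.-1; have := am (lo r); lia.
have jk' : (j.+1 + k' = m)%N by lia.
have nextP d : valid (support alpha j) d -> adjacent c d -> stair d.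
  move=> vd; apply: stair_next st vd => i; rewrite inE leq_eqVlt => /orP[/eqP Ei|lt].
    by rewrite (_ : i = hi r) ?(ltn_trans ja ascent_lt) //; exact: val_inj.
  by apply: leq_trans ja _; apply: ascent_le.
have {}IH d : valid (support alpha j) d -> adjacent c d ->
    swapinv r (total (supports alpha j.+1 k'.+1) d) /\
    swapinv r ('X_(lo r) * (tails (supports alpha j.+1 k'.+1) d -
                        tails (supports (alpha \o swap r) j.+1 k'.+1) d)).
  move=> vd A; have Ej' : (a - j.+1)%N = e by lia.
  exact: IH Ej' _ _ _ jk' ja vd (nextP d vd A).
rewrite Ek'.
rewrite -[supports alpha j _]/(support alpha j :: supports alpha j.+1 k'.+1).
rewrite -[supports _ j _]/(support (alpha \o swap r) j ::
                         supports (alpha \o swap r) j.+1 k'.+1).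
rewrite support_swapr_lt //; split.
  rewrite /total; apply: swapinvM; first exact: swapinv_xcol_stair vc st.
  by rewrite [tails _ _]/=; apply: swapinv_sum => d /andP[vd A]; have [] := IH d vd A.
rewrite [X in X - _]/= [X in _ - X]/= -sumrB mulr_sumr.
apply: swapinv_sum => d /andP[vd A]; rewrite -mulrBr mulrCA; apply: swapinvM.
  by apply: swapinv_xcol_stair vd (nextP d vd A).
by have [] := IH d vd A.
Qed.

Definition base : {ffun 'I_n -> 'I_n.+1} := [ffun i => lift ord0 i].

Lemma demazure_tails m : (forall i, alpha i <= m)%N ->
  demazure r (tails (supports (alpha \o swap r) 0 m.+1) base)
  = tails (supports alpha 0 m.+1) base.
Proof.
move=> am.
have st : stair base by move=> i _; rewrite ffunE lift0.
have vb : valid setT base.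
  apply/validP; split=> [i|i k _]; first by rewrite ffunE lift0 inE.
  by rewrite !ffunE => /lift_inj.
have [] := @stair_inv m setT base 0 m am (add0n m) (leq0n _) vb st.
set G := tails (supports alpha _ _) _; set G' := tails _ _ => iG iD.
(* The weight of the basement is symmetric and nonzero, so it cancels from [total]. *)
have {}iG : swapinv r G.
  have nz : xcol base != 0.
    apply/prodf_neq0 => i _; rewrite ffunE /xval liftK /= -msupp_eq0 msuppX //.
  have iB := swapinv_xcol_stair vb st.
  by apply: (mulfI nz); move: iG; rewrite /total /swapinv msymM iB.
apply: divdiff_uniq.
(* The subtracted product is symmetric and drops out of the divided difference. *)
have -> : 'X_(lo r) * G' = 'X_(lo r) * G - 'X_(lo r) * (G - G').
  by rewrite mulrBr subKr.
rewrite [msym _ (_ - _)]msymB iD [msym _ (_ * G)]msymM iG msym_var tpermL.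
by rewrite opprB addrA subrK -mulrBl mulrC.
Qed.

End Ascent.

(** * Fillings as sequences of columns *)

Section Fillings.
Variable n : nat.
Implicit Types (c d : {ffun 'I_n -> 'I_n.+1}) (S : {set 'I_n}).

Fixpoint column_paths (s : seq {set 'I_n}) c : seq (seq {ffun 'I_n -> 'I_n.+1}) :=
  if s is U :: s' then
    [seq d :: u | d <- enum [pred d | valid U d && adjacent c d],
                  u <- column_paths s' d]
  else [:: [::]].

Lemma mem_column_paths s c u :
  (u \in column_paths s c) = path (@adjacent n) c u && all2 (@valid n) s u.
Proof.
elim: s c u => [|S s IH] c [|d u] //=; first by rewrite inE andbF.
  by apply/allpairsPdep => -[d [u []]].
apply/allpairsPdep/idP => [[d' [u' []]]|].
  by rewrite mem_enum inE IH => /andP[V A] /andP[P Vs] [-> ->]; rewrite A P V.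
move=> /andP[/andP[A P] /andP[V Vs]]; exists d, u.
by rewrite mem_enum inE IH V A P Vs.
Qed.

Lemma uniq_column_paths s c : uniq (column_paths s c).
Proof.
elim: s c => [|S s IH] c //=.
apply: allpairs_uniq_dep => [|d _|]; [exact: enum_uniq|exact: IH|].
by move=> [d u] [d' u'] _ _ /= [-> ->].
Qed.

Lemma tails_column_paths s c :
  tails s c = \sum_(u <- column_paths s c) \prod_(d <- u) xcol d.
Proof.
elim: s c => [|S s IH] c /=; first by rewrite big_seq1 big_nil.
rewrite big_allpairs_dep /= big_enum /=; apply: eq_bigr => d _.
by rewrite IH mulr_sumr; apply: eq_bigr => u _; rewrite big_cons.
Qed.

Variable alpha : 'I_n -> nat.
Notation row := (@Defs.row n alpha).
Notation col := (@Defs.col n alpha).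
Implicit Types F : {ffun box alpha -> 'I_n}.

Definition mkbox (i : 'I_n) (j : 'I_(alpha i)) : box alpha :=
  Tagged (fun i => 'I_(alpha i)) j.

Definition entry F (i : 'I_n) (j : nat) : 'I_n.+1 :=
  if insub j is Some j' then lift ord0 (F (@mkbox i j')) else ord0.

Definition column F j : {ffun 'I_n -> 'I_n.+1} := [ffun i => entry F i j].

Lemma entry_box F b : entry F (row b) (col b) = lift ord0 (F b).
Proof. by case: b => i j; rewrite /entry /Defs.row /Defs.col /= valK. Qed.

Lemma columnE F b : column F (col b) (row b) = (F b).+1 :> nat.
Proof. by rewrite ffunE entry_box lift0. Qed.

Lemma col_lt (b : box alpha) : (col b < alpha (row b))%N.
Proof. exact: ltn_ord. Qed.

Lemma boxP i j : (j < alpha i)%N -> exists b : box alpha, row b = i /\ col b = j.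
Proof. by move=> ji; exists (mkbox (Ordinal ji)). Qed.

Lemma column_gt0 F i j : (0 < column F j i)%N = (j < alpha i)%N.
Proof.
rewrite ffunE /entry; case: insubP => [j' -> _|/negbTE->]; rewrite ?lift0 //.
Qed.

(** Distinctness within columns becomes [valid], conditions between neighbouring columns become
    [adjacent], and weak decrease along a whole row follows by transitivity. *)
Lemma semistandard_column_path F m : (forall i, alpha i <= m)%N ->
  (F \in SSF alpha) =
  ([seq column F j | j <- iota 0 m.+1] \in column_paths (supports alpha 0 m.+1) (base n)).
Proof.
move=> am; rewrite inE mem_column_paths.
have -> : all2 (@valid n) (supports alpha 0 m.+1) [seq column F j | j <- iota 0 m.+1]
        = all (fun j => valid (support alpha j) (column F j)) (iota 0 m.+1).
  by rewrite /supports; elim: (iota 0 m.+1) => //= j s ->.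
rewrite [path _ _ _]/=.
have -> : path (@adjacent n) (column F 0) [seq column F j | j <- iota 1 m]
        = all (fun j => adjacent (column F j) (column F j.+1)) (iota 0 m).
  by elim: {am}m 0%N => //= m IH j; rewrite IH.
have gt0 b : (0 < column F (col b) (row b))%N by rewrite columnE.
apply/idP/idP.
  move=> /and5P[_ /forallP dec /forallP flag /forallP dist /forallP trip].
  have {}dec b b' : row b = row b' -> (col b <= col b')%N -> (F b' <= F b)%N.
    by move=> e le; move/forallP/(_ b')/implyP: (dec b); rewrite e eqxx le; apply.
  have dst b b' : col b = col b' -> F b = F b' -> row b = row b'.
    move=> ec eF; apply/eqP/negPn/negP => ne.
    by move/forallP/(_ b')/implyP: (dist b); rewrite ec ne eF !eqxx => /(_ isT).
  have {}trip b b' : col b = col b' -> (row b < row b')%N -> (F b' < F b)%N ->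
      exists b2, [/\ row b2 = row b, col b2 = (col b).+1 & (F b' < F b2)%N].
    move=> ec lr lF; move/forallP/(_ b')/implyP: (trip b).
    rewrite ec eqxx lr ltnS lF => /(_ isT)/existsP[b2 /and3P[/eqP e1 /eqP e2 e3]].
    by exists b2; rewrite e1 e2; split.
  rewrite -andbA; apply/and3P; split.
  (* The basement increases downwards, so it has no inversions. *)
  - apply/adjacentP; split=> [i|i k ik _]; last by rewrite !ffunE !lift0; lia.
    have [z|/boxP[b [<- Eb]]] := leqP (alpha i) 0.
      by move: (column_gt0 F i 0) z; lia.
    rewrite -Eb columnE ffunE lift0; exact: flag.
  - apply/allP => j _; apply/adjacentP; split=> [i|i k ik].
      have [z|lt] := leqP (alpha i) j.+1.
        by move: (column_gt0 F i j.+1) z; lia.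
      have [b [Er Ec]] := boxP lt; have [b' [Er' Ec']] := boxP (ltnW lt).
      rewrite -Ec -{1}Er -Ec' -Er' !columnE ltnS.
      by apply: dec; rewrite ?Er ?Er' ?Ec ?Ec'.
    rewrite column_gt0 => /boxP[b' [Er' Ec']] lF; subst k.
    have : (j < alpha i)%N by rewrite -(column_gt0 F); lia.
    move=> /boxP[b [Er Ec]].
    move: lF ik; rewrite -{1}Ec' -{1}Ec -Er !columnE ltnS => lF ik.
    have [b2 [Er2 Ec2 Fc]] := trip b b' (etrans Ec (esym Ec')) ik lF.
    by rewrite -{1}Ec' -Ec -Ec2 -Er2 !columnE ltnS.
  apply/allP => j _; apply/validP; split=> [i|i k]; first by rewrite column_gt0 inE.
  rewrite column_gt0 => ji e.
  have jk : (j < alpha k)%N by rewrite -(column_gt0 F) -e column_gt0.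
  have [b [Er Ec]] := boxP ji; have [b' [Er' Ec']] := boxP jk.
  rewrite -Er -Er'; apply: dst; first by rewrite Ec.
  move/(congr1 val): e => /=; rewrite -{1}Ec -Ec' -Er -Er' !columnE => -[E].
  exact: val_inj.
move=> /andP[/andP[/adjacentP[flag _] /allP adj] /allP vld].
have colm b : (col b < m)%N by apply: leq_trans (col_lt b) (am _).
have {}adj j : (j < m)%N -> adjacent (column F j) (column F j.+1).
  by move=> jm; apply: adj; rewrite mem_iota.
have {}vld j : (j < m.+1)%N -> valid (support alpha j) (column F j).
  by move=> jm; apply: vld; rewrite mem_iota.
have dec i j k : (j + k <= m)%N -> (column F (j + k) i <= column F j i)%N.
  elim: k => [|k IH] le; first by rewrite addn0.
  apply: leq_trans (IH _); last by lia.
  rewrite addnS; have /adjacentP[H _] : adjacent (column F (j + k)) (column F (j + k).+1).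
    by apply: adj; lia.
  exact: H.
apply/and5P; split.
- exact/forallP.
- apply/forallP => b; apply/forallP => b'; apply/implyP => /andP[/eqP er le].
  have := dec (row b) (col b) (col b' - col b)%N; rewrite subnKC // columnE er columnE.
  by apply; apply: ltnW.
- apply/forallP => b.
  have := dec (row b) 0%N (col b) (ltnW (colm b)).
  rewrite add0n columnE => /leq_trans; apply.
  by have := flag (row b); rewrite [base n _]ffunE lift0.
- apply/forallP => b; apply/forallP => b'; apply/implyP => /andP[/eqP ec ne].
  have /validP[_ D] := vld (col b) (ltnW (colm b)).
  apply: contraNneq ne => eF; apply/eqP; apply: D => //.
  by apply: val_inj; rewrite /= columnE ec columnE.
apply/forallP => b; apply/forallP => b'; apply/implyP => /and3P[/eqP ec lr lF].
have /adjacentP[_ H] := adj (col b) (colm b).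
have := H _ _ lr; rewrite columnE ec gt0 !columnE -ec => /(_ isT lF) lt.
(* The next entry exceeds a positive one, so its box exists. *)
have jr : ((col b).+1 < alpha (row b))%N by rewrite -(column_gt0 F); lia.
have [b2 [Er Ec]] := boxP jr; apply/existsP; exists b2.
by rewrite Er Ec !eqxx /= -(columnE F b2) Er Ec.
Qed.

Lemma weight_columns F m : (forall i, alpha i <= m)%N ->
  weight F = \prod_(d <- [seq column F j | j <- iota 0 m.+1]) xcol d.
Proof.
move=> am; rewrite big_map /xcol exchange_big.
under [RHS]eq_bigr do under eq_bigr do rewrite ffunE.
transitivity (\prod_(i < n) \prod_(j < alpha i) ('X_(F (mkbox j)) : {mpoly int[n]})).
  rewrite sig_big_dep /= /weight; apply: eq_big => // -[i j] _.
  by [].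
apply: eq_bigr => i _.
have -> : iota 0 m.+1 = index_iota 0 m.+1 by rewrite /index_iota subn0.
(* Positions past the end of row [i] have weight 1. *)
rewrite (big_cat_nat (n := alpha i)) //=; last by rewrite leqW.
rewrite [X in _ * X]big_nat_cond [X in _ * X]big1 ?mulr1
  => [|j /andP[/andP[ij _] _]]; last first.
  by rewrite /entry insubN -?leqNgt // /xval unlift_none.
rewrite big_mkord; apply: eq_bigr => j _.
by rewrite /entry valK /xval liftK.
Qed.

Lemma sum_SSF_tails m : (forall i, alpha i <= m)%N ->
  \sum_(F in SSF alpha) weight F = tails (supports alpha 0 m.+1) (base n).
Proof.
move=> am; rewrite tails_column_paths.
pose cols F := [seq column F j | j <- iota 0 m.+1].
rewrite -big_enum.
under eq_bigr do rewrite (weight_columns _ am).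
rewrite -(big_map cols xpredT (fun u => \prod_(d <- u) xcol d)).
apply: perm_big; apply: uniq_perm; last move=> u.
- rewrite map_inj_uniq ?enum_uniq // => F G e.
  apply/ffunP => b; apply: (@lift_inj _ ord0); rewrite -!entry_box.
  have jm : (col b < m.+1)%N by rewrite ltnW // ltnS (leq_trans (col_lt b)).
  have := congr1 (fun u => nth (base n) u (col b)) e.
  rewrite !(nth_map 0%N) ?size_iota // nth_iota // add0n.
  by move=> /ffunP/(_ (row b)); rewrite !ffunE.
- exact: uniq_column_paths.
apply/mapP/idP => [[F]|up].
  by rewrite mem_enum (semistandard_column_path _ am) => ? ->.
(* The default [row b] is never reached, because a valid column is positive on its support. *)
pose F : {ffun box alpha -> 'I_n} :=
  [ffun b => odflt (row b) (unlift ord0 (nth (base n) u (col b) (row b)))].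
have Eu : u = cols F.
  have := up; rewrite mem_column_paths all2E => /andP[_ /andP[/eqP sz /allP V]].
  rewrite size_map size_iota in sz.
  apply: (@eq_from_nth _ (base n)); rewrite ?size_map ?size_iota -?sz // => j jm.
  rewrite (nth_map 0%N) ?size_iota // nth_iota // add0n.
  have /validP[Vj _] : valid (support alpha j) (nth (base n) u j).
    have := V (support alpha j, nth (base n) u j); apply.
    apply/(nthP (set0, base n)); exists j.
      by rewrite size_zip size_map size_iota -sz minnn.
    rewrite nth_zip ?size_map ?size_iota //.
    by rewrite (nth_map 0%N) ?size_iota // nth_iota.
  apply/ffunP => i; rewrite ffunE /entry.
  case: insubP => [j' lt Ej'|ge].
    rewrite ffunE /Defs.row /Defs.col /= Ej'; case: unliftP => [v ->//|E].
    by have := Vj i; rewrite E inE lt.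
  by apply: val_inj => /=; have := Vj i; rewrite inE (negbTE ge); lia.
exists F => //.
by rewrite mem_enum (semistandard_column_path _ am) -/(cols F) -Eu.
Qed.

End Fillings.

Unset Implicit Arguments.

Theorem mainTheorem2 (n : nat) (alpha : 'I_n -> nat) (r : 'I_n.-1)
    (not_decreasing : ~~ weakly_decreasing alpha)
    (r_first_ascent : first_ascent alpha r) :
  demazure r (\sum_(F' in SSF (alpha \o swap r)) weight F')
  = \sum_(F in SSF alpha) weight F.
Proof.
(* The same bound serves the swapped shape, whose rows have the same lengths in another order. *)
pose m := \max_(i < n) alpha i.
have am i : (alpha i <= m)%N by apply: leq_bigmax.
by rewrite !(@sum_SSF_tails _ _ m) ?(demazure_tails r_first_ascent) // => i; apply: am.
Qed.
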